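(* Let $\ell\ge 2$ and $m\ge 1$ be integers. For integers $s,r\geq 2$, \begin{align*} \operatorname{PR}_{\mathcal{Q}(\ell)}^2(\diamond_s,\vee_r)\leq\operatorname{PR}_{\mathcal{Q}(\ell)}^2(\wedge_{s+r},\vee_r)\leq\left\lceil\log_{(\ell+1)/2}(2r+s-1)\right\rceil \quad\text{and}\\ \operatorname{PR}_{\mathcal{H}(m)}^2(\diamond_s,\vee_r)\leq\operatorname{PR}_{\mathcal{H}(m)}^2(\wedge_{s+r},\vee_r)\leq \left\lceil 2(2r+s-1)^{1/m}\right\rceil-1. \end{align*}
   Context: $[\ell]^m$ denotes the grid poset of $m$-tuples with entries in $\{1,\dots,\ell\}$, ordered coordinatewise. $\mathcal{Q}(\ell)=\{Q_n(\ell):n\ge1\}$ with $Q_n(\ell)=[\ell]^n$, and $\mathcal{H}(m)=\{H_n(m):n\ge1\}$ with $H_n(m)=[n]^m$. 2-uniform pographs: $\vee_r$ has poset $\{x,y_1,\dots,y_r\}$ with $x\le y_i$ and edges $xy_i$; $\wedge_r$ has poset $\{y,x_1,\dots,x_r\}$ with $x_i\le y$ and edges $x_iy$; $\diamond_s$ has poset $\{x,y_1,\dots,y_s,z\}$ with $x\le y_i\le z$ and edges $xy_i,y_iz$. Given a coloring of the comparable pairs of a poset $Q$, a copy of $H$ in color $i$ is an injection $f:V(H)\to Q$ with $f(x)\le f(y)$ whenever $x\le y$ such that every edge of $H$ is mapped to a pair of color $i$. For a family $\mathcal{P}=\{P_n\}$, $\operatorname{PR}_{\mathcal{P}}^2(G_1,G_2)$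 is the least $N$ such that every 2-coloring of the comparable pairs of $P_N$ contains a copy of $G_1$ in color 1 or of $G_2$ in color 2. *)

(* Defs.v *)
From HB Require Import structures.
From mathcomp Require Import all_boot all_order all_algebra.
From mathcomp Require Import reals exp.

Set Implicit Arguments.
Unset Strict Implicit.
Unset Printing Implicit Defensive.

Import Order.TTheory GRing.Theory Num.Theory.

Fact pograph_display : Order.disp_t.
Proof. exact: Order.Disp tt tt. Qed.

(* A 2-uniform pograph: a poset with a set of 2-element chains as edges.  The
   edge {x, y} with x < y is stored once, as the ordered pair (x, y). *)
Record pograph := Pograph {
  pvertex : finPOrderType pograph_display;
  pedge : rel pvertex;
  pedge_lt : forall x y : pvertex, pedge x y -> (x < y)%O }.

(* vee_vertex r = {x, y_1, ..., y_r}: None is x and Some i is y_{i+1}. *)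
Definition vee_vertex (r : nat) : Type := option 'I_r.
HB.instance Definition _ r := Finite.on (vee_vertex r).

Definition vee_le r (u v : vee_vertex r) : bool := (u == None) || (u == v).

Fact vee_le_refl r : reflexive (@vee_le r).
Proof. by move=> u; rewrite /vee_le eqxx orbT. Qed.

Fact vee_le_anti r : antisymmetric (@vee_le r).
Proof. by move=> [i|] [j|] //=; rewrite /vee_le /= => /andP[/eqP]. Qed.

Fact vee_le_trans r : transitive (@vee_le r).
Proof.
by move=> v u w /orP[/eqP->|/eqP->] //; rewrite /vee_le eqxx.
Qed.

HB.instance Definition _ r := Order.Le_isPOrder.Build pograph_display
  (vee_vertex r) (@vee_le_refl r) (@vee_le_anti r) (@vee_le_trans r).

Definition vee_edge r : rel (vee_vertex r) :=
  fun u v => (u == None) && (v != None).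

Fact vee_edge_lt r (u v : vee_vertex r) : vee_edge u v -> (u < v)%O.
Proof.
by move=> /andP[/eqP-> vN]; rewrite lt_neqAle eq_sym vN /Order.le /= /vee_le eqxx.
Qed.

Definition vee (r : nat) : pograph := Pograph (@vee_edge_lt r).

(* wedge_vertex r = {y, x_1, ..., x_r}: None is y and Some i is x_{i+1}. *)
Definition wedge_vertex (r : nat) : Type := option 'I_r.
HB.instance Definition _ r := Finite.on (wedge_vertex r).

Definition wedge_le r (u v : wedge_vertex r) : bool := (v == None) || (u == v).

Fact wedge_le_refl r : reflexive (@wedge_le r).
Proof. by move=> u; rewrite /wedge_le eqxx orbT. Qed.

Fact wedge_le_anti r : antisymmetric (@wedge_le r).
Proof. by move=> [i|] [j|] //=; rewrite /wedge_le /= => /andP[/eqP]. Qed.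

Fact wedge_le_trans r : transitive (@wedge_le r).
Proof.
by move=> v u w /[swap] /orP[/eqP->|/eqP->] //; rewrite /wedge_le eqxx.
Qed.

HB.instance Definition _ r := Order.Le_isPOrder.Build pograph_display
  (wedge_vertex r) (@wedge_le_refl r) (@wedge_le_anti r) (@wedge_le_trans r).

Definition wedge_edge r : rel (wedge_vertex r) :=
  fun u v => (u != None) && (v == None).

Fact wedge_edge_lt r (u v : wedge_vertex r) : wedge_edge u v -> (u < v)%O.
Proof.
by move=> /andP[uN /eqP->]; rewrite lt_neqAle uN /Order.le /= /wedge_le eqxx.
Qed.

Definition wedge (r : nat) : pograph := Pograph (@wedge_edge_lt r).

(* diamond_vertex s = {x, y_1, ..., y_s, z}: inl false is x, inl true is z and
   inr i is y_{i+1}. *)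
Definition diamond_vertex (s : nat) : Type := (bool + 'I_s)%type.
HB.instance Definition _ s := Finite.on (diamond_vertex s).

Definition diamond_le s (u v : diamond_vertex s) : bool :=
  [|| u == inl false, v == inl true | u == v].

Fact diamond_le_refl s : reflexive (@diamond_le s).
Proof. by move=> u; rewrite /diamond_le eqxx !orbT. Qed.

Fact diamond_le_anti s : antisymmetric (@diamond_le s).
Proof.
by move=> [[]|i] [[]|j] //=; rewrite /diamond_le /= => /andP[/eqP].
Qed.

Fact diamond_le_trans s : transitive (@diamond_le s).
Proof.
move=> v u w /or3P[/eqP->|/eqP->|/eqP->] //.
by move=> /or3P[//|/eqP->|/eqP<-]; rewrite /diamond_le eqxx !orbT.
Qed.

HB.instance Definition _ s := Order.Le_isPOrder.Build pograph_display
  (diamond_vertex s) (@diamond_le_refl s) (@diamond_le_anti s)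
  (@diamond_le_trans s).

Definition diamond_edge s : rel (diamond_vertex s) := fun u v =>
  match u, v with
  | inl false, inr _ => true
  | inr _, inl true => true
  | _, _ => false
  end.

Fact diamond_edge_lt s (u v : diamond_vertex s) : diamond_edge u v -> (u < v)%O.
Proof. by case: u v => [[]|i] [[]|j]. Qed.

Definition diamond (s : nat) : pograph := Pograph (@diamond_edge_lt s).

(* A 2-coloring of the comparable pairs of Q is a map c : Q -> Q -> bool of
   which only the values c a b with a < b matter; true is color 1 and false is
   color 2.  Since f is injective and monotone, has_copy reads c only there. *)
Definition has_copy d (Q : finPOrderType d) (c : Q -> Q -> bool) (i : bool)
    (H : pograph) : Prop :=
  exists f : pvertex H -> Q,
    [/\ injective f,
        forall x y : pvertex H, (x <= y)%O -> (f x <= f y)%O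
      & forall x y : pvertex H, pedge x y -> c (f x) (f y) = i].

Definition arrows d (Q : finPOrderType d) (G1 G2 : pograph) : Prop :=
  forall c : Q -> Q -> bool, has_copy c true G1 \/ has_copy c false G2.

(* is_PR P G1 G2 N : the poset Ramsey number PR_P^2(G1, G2) of the family
   P = {P n : n >= 1} exists and equals N. *)
Definition is_PR d (P : nat -> finPOrderType d) (G1 G2 : pograph) (N : nat) :
    Prop :=
  [/\ (0 < N)%N, arrows (P N) G1 G2
    & forall n, (0 < n)%N -> arrows (P n) G1 G2 -> (N <= n)%N].

(* The grid poset [l]^m, ordered coordinatewise, with entries shifted from
   {1, ..., l} to {0, ..., l - 1}. *)
Definition grid (l m : nat) := m.-tupleprod 'I_l.

Definition Qfam (l n : nat) : finPOrderType _ := grid l n.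
Definition Hfam (m n : nat) : finPOrderType _ := grid n m.

Definition logb (R : realType) (b x : R) : R := (ln x / ln b)%R.

(* Main.v *)
Require Import Defs.
From mathcomp Require Import all_boot all_order all_algebra.
From mathcomp Require Import boolp reals exp.
From mathcomp Require Import zify lra.

Set Implicit Arguments.
Unset Strict Implicit.
Unset Printing Implicit Defensive.

Import Order.TTheory GRing.Theory Num.Theory.
Local Open Scope ring_scope.

(** Both upper bounds come from one count in a finite poset [Q] with a bottom element. If a coloring
    has no wedge with [a] lower vertices in color 1 and no vee with [r] upper vertices in color 2,
    each element has at most [a - 1] color-1 pairs below it and at most [r - 1] color-2 pairs above
    it. With the diagonal, [Q] then has fewer than [#|Q| * (a + r - 1)] pairs [x <= y]
    ([arrows_wedge_vee]). The grid has ['C(l + 1, 2) ^ n] such pairs (the lower bound is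
    [card_le_grid]), that is, [((l + 1) / 2) ^ n] per element. With [a = s + r], the arrow thus
    holds once [((l + 1) / 2) ^ n >= 2r + s - 1] ([arrows_grid]). Solving for the dimension gives
    the logarithm; solving for the side length gives the root.

    The diamond bound holds inside a single poset: the bottom element and the top of a color-1 wedge
    are the ends of the diamond ([arrows_diamond_vee]). *)

Lemma card_ge_injection (T : finType) (A : {set T}) (k : nat) :
  (k <= #|A|)%N -> exists2 g : 'I_k -> T, injective g & forall i, g i \in A.
Proof.
move=> kA; exists (fun i => enum_val (widen_ord kA i)) => [i j|i].
  by move=> /enum_val_inj/(congr1 val) ij; apply: val_inj.
exact: enum_valP.
Qed.

Lemma has_copy_vee d (Q : finPOrderType d) (c : Q -> Q -> bool) b k (x : Q) :
  (k <= #|[set y | (x < y)%O & c x y == b]|)%N -> has_copy c b (vee k).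
Proof.
move=> /card_ge_injection[g ginj gP].
have gE i : (x < g i)%O /\ c x (g i) = b.
  by have := gP i; rewrite inE => /andP[? /eqP].
exists (fun u : vee_vertex k => if u is Some i then g i else x); split.
- move=> [i|] [j|] //= => [/ginj->//|xi|xi].
    by have := (gE i).1; rewrite xi ltxx.
  by have := (gE j).1; rewrite -xi ltxx.
- move=> u v; rewrite -[(u <= v)%O]/(vee_le u v) /vee_le.
  move: u v => [i|] [j|] //=.
    by move=> /eqP[->]; rewrite lexx.
  by move=> _; apply: ltW (gE j).1.
- by move=> [i|] [j|] //= _; apply: (gE j).2.
Qed.

Lemma has_copy_wedge d (Q : finPOrderType d) (c : Q -> Q -> bool) b k (y : Q) :
  (k <= #|[set x | (x < y)%O & c x y == b]|)%N -> has_copy c b (wedge k).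
Proof.
move=> /card_ge_injection[g ginj gP].
have gE i : (g i < y)%O /\ c (g i) y = b.
  by have := gP i; rewrite inE => /andP[? /eqP].
exists (fun u : wedge_vertex k => if u is Some i then g i else y); split.
- move=> [i|] [j|] //= => [/ginj->//|xi|xi].
    by have := (gE i).1; rewrite xi ltxx.
  by have := (gE j).1; rewrite -xi ltxx.
- move=> u v; rewrite -[(u <= v)%O]/(wedge_le u v) /wedge_le.
  move: u v => [i|] [j|] //=.
    by move=> /eqP[->]; rewrite lexx.
  by move=> _; apply: ltW (gE i).1.
- by move=> [i|] [j|] //= _; apply: (gE i).2.
Qed.

Lemma has_copy_diamond d (Q : finPOrderType d) (c : Q -> Q -> bool) b k
    (x z : Q) : (0 < k)%N ->
  (k <= #|[set y | (x < y < z)%O & (c x y == b) && (c y z == b)]|)%N ->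
  has_copy c b (diamond k).
Proof.
move=> k_gt0 /card_ge_injection[g ginj gP].
have gE i : [/\ (x < g i)%O, (g i < z)%O, c x (g i) = b & c (g i) z = b].
  by have := gP i; rewrite inE => /andP[/andP[? ?] /andP[/eqP? /eqP?]].
have xg i : (x < g i)%O by case: (gE i).
have gz i : (g i < z)%O by case: (gE i).
(* The ends of the diamond are compared through a middle vertex, which exists as [0 < k]. *)
have xz : (x < z)%O := lt_trans (xg (Ordinal k_gt0)) (gz _).
exists (fun u : diamond_vertex k =>
  match u with inl false => x | inl true => z | inr i => g i end); split.
- move=> [[]|i] [[]|j] //= => [e|e|e|e|e|e|/ginj->//].
  + by move: xz; rewrite e ltxx.
  + by move: (gz j); rewrite e ltxx.
  + by move: xz; rewrite e ltxx.
  + by move: (xg j); rewrite e ltxx.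
  + by move: (gz i); rewrite e ltxx.
  + by move: (xg i); rewrite e ltxx.
- move=> u v; rewrite -[(u <= v)%O]/(diamond_le u v) /diamond_le.
  move: u v => [[]|i] [[]|j] //= => e.
  + exact: ltW xz.
  + exact: ltW (xg j).
  + exact: ltW (gz i).
  + by move/eqP: e => [->]; exact: lexx.
- by move=> [[]|i] [[]|j] //= _; [case: (gE j)|case: (gE i)].
Qed.

(* A wedge in color 1 has s + r lower vertices.  Joined to the bottom element,
   fewer than r of them give color 2 (else there is a vee), and one of them may
   be the bottom element itself; the other s vertices form the diamond. *)
Lemma arrows_diamond_vee d (Q : finPOrderType d) (bot : Q) (s r : nat) :
  (forall x, (bot <= x)%O) -> (0 < s)%N -> (0 < r)%N ->
  arrows Q (wedge (s + r)) (vee r) -> arrows Q (diamond s) (vee r).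
Proof.
move=> botP s_gt0 r_gt0 arr c; have [[f [finj fle fedge]]|] := arr c; last by right.
pose z := f None.
pose X : {set Q} := [set f (Some i) | i : 'I_(s + r)].
have cardX : #|X| = (s + r)%N.
  rewrite card_imset ?card_ord // => i j /finj; by case.
have Xz x : x \in X -> (x < z)%O /\ c x z = true.
  move=> /imsetP[i _ ->]; split; last by rewrite /z fedge.
  rewrite lt_neqAle fle ?andbT; last by rewrite /Order.le.
  by apply/eqP => /finj.
pose B := [set y | (bot < y)%O & c bot y == false].
have [rB|Br] := leqP r #|B|; first by right; exact: has_copy_vee rB.
left; apply: (@has_copy_diamond _ _ _ _ _ bot z) => //.
pose D := X :\: (bot |: B).
apply: (@leq_trans #|D|); last first.
  apply: subset_leq_card; apply/subsetP => x; rewrite !inE negb_or negb_and.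
  move=> /andP[/andP[xbot xB] /Xz[-> ->]].
  have xgt : (bot < x)%O by rewrite lt_neqAle eq_sym xbot botP.
  by move: xB; rewrite xgt /= andbT; case: (c bot x).
have := cardsID (bot |: B) X; rewrite -/D cardX.
have := subset_leq_card (subsetIr X (bot |: B)).
have := cardsU1 bot B; have := leq_b1 (bot \notin B).
by lia.
Qed.

(* Counting the comparable pairs: the color-1 pairs by their upper element, the
   color-2 pairs by their lower element.  The bottom element is the upper
   element of no pair, which makes the non-strict inequality sufficient. *)
Lemma arrows_wedge_vee d (Q : finPOrderType d) (bot : Q) (a r : nat) :
  (forall x, (bot <= x)%O) -> (1 < a)%N -> (0 < r)%N ->
  (#|Q| * (a + r).-1 <= #|[set p : Q * Q | (p.1 <= p.2)%O]|)%N ->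
  arrows Q (wedge a) (vee r).
Proof.
move=> botP a_gt1 r_gt0 pairs c.
pose A y := [set x | (x < y)%O & c x y == true].
pose B x := [set y | (x < y)%O & c x y == false].
have [/existsP[y /has_copy_wedge]|] := boolP [exists y, (a <= #|A y|)%N].
  by left.
have [/existsP[x /has_copy_vee]|] := boolP [exists x, (r <= #|B x|)%N].
  by right.
move=> /existsPn Bs /existsPn As; exfalso.
(* Each pair [x <= y] is exactly one of: equal, strict of color 1, strict of color 2. *)
have pairsE : #|[set p : Q * Q | (p.1 <= p.2)%O]| =
    (#|Q| + \sum_y #|A y| + \sum_x #|B x|)%N.
  have -> : (\sum_y #|A y| = \sum_x \sum_y ((x < y)%O && c x y))%N.
    rewrite exchange_big; apply: eq_bigr => y _.
    rewrite -sum1dep_card big_mkcond; apply: eq_bigr => x _.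
    by case: (_ < _)%O; case: (c x y).
  have -> : (\sum_x #|B x| = \sum_x \sum_y ((x < y)%O && ~~ c x y))%N.
    apply: eq_bigr => x _.
    rewrite -sum1dep_card big_mkcond; apply: eq_bigr => y _.
    by case: (_ < _)%O; case: (c x y).
  have -> : (#|Q| = \sum_(x : Q) \sum_(y : Q) (x == y))%N.
    rewrite -sum1_card; apply: eq_bigr => x _.
    by rewrite (bigD1 x) //= eqxx big1 // => y; rewrite eq_sym => /negPf->.
  rewrite -!big_split /= -sum1dep_card big_mkcond /=.
  rewrite -(pair_bigA _ (fun x y : Q => if (x <= y)%O then 1 else 0)%N) /=.
  apply: eq_bigr => x _; rewrite -!big_split; apply: eq_bigr => y _ /=.
  rewrite le_eqVlt; case: eqVneq => [->|_]; first by rewrite ltxx.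
  by case: (x < y)%O; case: (c x y).
have Abot : A bot = set0.
  apply/setP => x; rewrite !inE; apply/negbTE/negP => /andP[xb _].
  by have := lt_le_trans xb (botP x); rewrite ltxx.
have leA : (\sum_y #|A y| <= #|Q|.-1 * a.-1)%N.
  rewrite (bigD1 bot) //= Abot cards0 add0n -(cardC1 bot) -sum_nat_const.
  rewrite (eq_bigl (fun y => y \in predC1 bot)) //.
  by apply: leq_sum => y _; rewrite -ltnS prednK ?(ltnW a_gt1) // ltnNge As.
have leB : (\sum_x #|B x| <= #|Q| * r.-1)%N.
  rewrite -sum_nat_const; apply: leq_sum => x _.
  by rewrite -ltnS prednK // ltnNge Bs.
have Q_gt0 : (0 < #|Q|)%N by apply/card_gt0P; exists bot.
have {pairs} : (#|Q| * (a + r).-1 <= #|Q| + #|Q|.-1 * a.-1 + #|Q| * r.-1)%N.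
  rewrite pairsE in pairs; lia.
(* The right-hand side equals [q * (a + r - 1) - (a - 1)], which is too small since [1 < a]. *)
by move: (#|Q|) Q_gt0 => q q_gt0; nia.
Qed.

Lemma card_le_ord (l : nat) :
  #|[pred p : 'I_l * 'I_l | (p.1 <= p.2)%N]| = 'C(l.+1, 2).
Proof.
rewrite -sum1_card big_mkcond /=.
rewrite -(pair_bigA _ (fun x y : 'I_l => if (x <= y)%N then 1 else 0)%N) /=.
(* Grouped by larger entry: [j] has [j + 1] entries at or below it. *)
rewrite exchange_big /= -bin2_sum big_nat_recl // add0n big_mkord.
apply: eq_bigr => j _; rewrite -big_mkcond /=.
by rewrite (big_ord_narrow (ltn_ord j)) sum1_card card_ord.
Qed.

(** The order is coordinatewise, so choosing a comparable pair of ['I_l] in each coordinate gives a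
    comparable pair of the grid, and distinct choices give distinct pairs. *)
Lemma card_le_grid (l n : nat) :
  ('C(l.+1, 2) ^ n <=
    #|[set p : grid l n * grid l n | (p.1 <= p.2)%O]|)%N.
Proof.
rewrite -card_le_ord -[n in (_ ^ n)%N]card_ord -card_ffun_on.
pose F (f : {ffun 'I_n -> 'I_l * 'I_l}) : grid l n * grid l n :=
  ([tuple (f i).1 | i < n], [tuple (f i).2 | i < n]).
rewrite -(@card_in_imset _ _ F) => [|f g _ _ Ffg].
  apply/subset_leq_card/subsetP => _ /imsetP[f /ffun_onP fP ->].
  rewrite inE leEtprod; apply/forallP => i.
  by rewrite !tnth_mktuple leEord; exact: fP.
apply/ffunP => i; rewrite [f i]surjective_pairing [g i]surjective_pairing.
have := congr1 (fun p => tnth p.2 i) Ffg.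
have := congr1 (fun p => tnth p.1 i) Ffg.
by rewrite !tnth_mktuple => -> ->.
Qed.

Lemma grid_bot (l n : nat) : (0 < l)%N ->
  exists bot : grid l n, forall x, (bot <= x)%O.
Proof.
move=> l_gt0; exists [tuple Ordinal l_gt0 | _ < n] => x.
by rewrite leEtprod; apply/forallP => i; rewrite tnth_mktuple leEord.
Qed.

Lemma arrows_grid (R : realType) (l n s r : nat) :
  (0 < l)%N -> (0 < s)%N -> (0 < r)%N ->
  2 * r%:R + s%:R - 1 <= ((l%:R + 1) / 2 : R) ^+ n ->
  arrows (grid l n) (wedge (s + r)) (vee r).
Proof.
move=> l_gt0 s_gt0 r_gt0 le_n; have [bot botP] := grid_bot n l_gt0.
apply: (arrows_wedge_vee botP) => //; first by lia.
apply: leq_trans (card_le_grid l n).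
rewrite card_tuple card_ord -(ler_nat R) natrM !natrX.
have -> : 'C(l.+1, 2)%:R = l%:R * ((l%:R + 1) / 2) :> R.
  have : (2 * 'C(l.+1, 2) = l.+1 * l)%N by rewrite -mul_bin_diag bin1.
  by move=> /(congr1 (fun k => k%:R : R)); rewrite !natrM -(natr1 l); lra.
rewrite exprMn ler_wpM2l ?exprn_ge0 //.
have -> : (s + r + r).-1%:R = 2 * r%:R + s%:R - 1 :> R.
  by rewrite -subn1 natrB ?natrD; [lra|lia].
exact: le_n.
Qed.

(** Classical reasoning turns [arrows] into a boolean, so the least witness exists. *)
Lemma is_PR_le d (P : nat -> finPOrderType d) G1 G2 n :
  (0 < n)%N -> arrows (P n) G1 G2 -> exists2 N, is_PR P G1 G2 N & (N <= n)%N.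
Proof.
move=> n_gt0 arr.
have ex : exists k, (0 < k)%N && `[< arrows (P k) G1 G2 >].
  by exists n; rewrite n_gt0; apply/asboolP.
case: (ex_minnP ex) => N /andP[N_gt0 /asboolP arrN] minN; exists N.
  by split=> // k k_gt0 arrk; apply: minN; rewrite k_gt0; apply/asboolP.
by apply: minN; rewrite n_gt0; apply/asboolP.
Qed.

Lemma is_PR_diamond_wedge d (P : nat -> finPOrderType d) (n s r : nat) :
  (forall k, (0 < k)%N -> exists bot : P k, forall x, (bot <= x)%O) ->
  (0 < s)%N -> (0 < r)%N -> (0 < n)%N ->
  arrows (P n) (wedge (s + r)) (vee r) ->
  exists N1 N2, [/\ is_PR P (diamond s) (vee r) N1,
    is_PR P (wedge (s + r)) (vee r) N2, (N1 <= N2)%N & (N2 <= n)%N].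
Proof.
move=> Pbot s_gt0 r_gt0 n_gt0 /(is_PR_le n_gt0)[N2 PR2 N2n].
have [N2_gt0 arr2 _] := PR2; have [bot botP] := Pbot _ N2_gt0.
(* Both arrows are compared in the same poset [P N2], so [N2] is a candidate for [N1]. *)
have [N1 PR1 N12] := is_PR_le N2_gt0 (arrows_diamond_vee botP s_gt0 r_gt0 arr2).
by exists N1, N2.
Qed.

Lemma le_expr_ceil_logb (R : realType) (b x : R) (n : nat) : 1 < b -> 0 < x ->
  Num.ceil (logb b x) = n%:Z -> x <= b ^+ n.
Proof.
move=> b_gt1 x_gt0 nE; have b_gt0 : 0 < b by lra.
rewrite -ler_ln ?posrE ?exprn_gt0 // lnXn // -mulr_natl.
rewrite -ler_pdivrMr ?ln_gt0 //; have := ceil_ge (logb b x).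
by rewrite nE.
Qed.

Lemma le_powR_inv_natr (R : realType) (x y : R) (m : nat) :
  (0 < m)%N -> 0 <= x -> 0 <= y -> powR x m%:R^-1 <= y -> x <= y ^+ m.
Proof.
move=> m_gt0 x_ge0 y_ge0 xy.
have <- : powR x m%:R^-1 ^+ m = x.
  by rewrite -powR_mulrn ?powR_ge0 // -powRrM mulVf ?pnatr_eq0 -?lt0n // powRr1.
by rewrite lerXn2r ?nnegrE ?powR_ge0.
Qed.

Theorem theorem5p3 (R : realType) (l m s r : nat)
    (hl : (2 <= l)%N) (hm : (1 <= m)%N) (hs : (2 <= s)%N) (hr : (2 <= r)%N) :
  (exists N1 N2 : nat,
    [/\ is_PR (Qfam l) (diamond s) (vee r) N1,
        is_PR (Qfam l) (wedge (s + r)) (vee r) N2,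
        (N1 <= N2)%N
      & N2%:Z <= Num.ceil (logb ((l%:R + 1) / 2 : R) (2 * r%:R + s%:R - 1))])
  /\
  (exists N1 N2 : nat,
    [/\ is_PR (Hfam m) (diamond s) (vee r) N1,
        is_PR (Hfam m) (wedge (s + r)) (vee r) N2,
        (N1 <= N2)%N
      & N2%:Z <=
        Num.ceil (2 * powR (2 * r%:R + s%:R - 1 : R) (m%:R^-1)) - 1]).
Proof.
have x_gt1 : 1 < 2 * r%:R + s%:R - 1 :> R.
  have : 2 <= r%:R :> R by rewrite ler_nat.
  have : 2 <= s%:R :> R by rewrite ler_nat.
  by lra.
have x_gt0 : 0 < 2 * r%:R + s%:R - 1 :> R by apply: lt_trans x_gt1.
have s_gt0 : (0 < s)%N by apply: ltnW.
have r_gt0 : (0 < r)%N by apply: ltnW.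
have l_gt0 : (0 < l)%N by apply: ltnW.
split.
- have b_gt1 : 1 < (l%:R + 1) / 2 :> R.
    have : 2 <= l%:R :> R by rewrite ler_nat.
    by lra.
  (* Base and argument exceed 1, so the ceiling is a positive integer and can serve as the dimension
     [n]. *)
  have := ceil_gt0 (logb ((l%:R + 1) / 2 : R) (2 * r%:R + s%:R - 1)).
  rewrite divr_gt0 ?ln_gt0 //.
  case nE: (Num.ceil _) => [n|] // n_gt0.
  have arr := arrows_grid l_gt0 s_gt0 r_gt0 (le_expr_ceil_logb b_gt1 x_gt0 nE).
  have := @is_PR_diamond_wedge _ (Qfam l) n s r (fun k _ => grid_bot k l_gt0).
  exact.
- set x := 2 * r%:R + s%:R - 1 in x_gt0 x_gt1 *.
  have rt_gt1 : 1 <= powR x m%:R^-1.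
    by rewrite -[leLHS](powRr0 x) (ler_powR (ltW x_gt1)) ?invr_ge0.
  have := ceil_gt_int (2 * powR x m%:R^-1) 1.
  have -> : 1%:~R < 2 * powR x m%:R^-1 by lra.
  (* The ceiling exceeds 1, so it is [n + 2], and the side length [n + 1] is positive. *)
  case nE: (Num.ceil _) => [[|[|n]]|] // _.
  have arr : arrows (Hfam m n.+1) (wedge (s + r)) (vee r).
    apply: (@arrows_grid R) => //; apply: le_powR_inv_natr => //; first exact: ltW.
      by rewrite divr_ge0 ?addr_ge0.
    (* A side one below the ceiling suffices, as the base of the power is half of side plus one,
       here [(n + 2) / 2]. *)
    have := ceil_ge (2 * powR x m%:R^-1); rewrite nE -/x.
    rewrite -[n.+2%:~R]/(n.+2%:R : R) -(natr1 n.+1); lra.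
  have := @is_PR_diamond_wedge _ (Hfam m) n.+1 s r (fun k => @grid_bot k m).
  rewrite -[n.+2%:Z - 1]/(n.+1%:Z).
  exact.
Qed.
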